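(* Let $p\in[1,\infty)\cup\{\infty\}$ and let $\alpha:\mathbb{R}\to\mathbb{R}^+_0$ be a function with $\alpha(0)=0$ such that the set $$\mathcal{U}:=\Big\{u\in L^p(\mathbb{R}^+_0,\mathbb{R}):\ \alpha\circ u \text{ is locally integrable but } \int_0^\infty\alpha(u(s))\,ds=\infty\Big\}$$ is non-empty (for instance, $\alpha(r):=|r|$ in case $p\neq1$ and $\alpha(r):=|r|^{1/2}$ in case $p=1$), and endow $\mathcal{U}$ with the norm $\|\cdot\|_{\mathcal{U}}:=\|\cdot\|_p$. Let $A$ be the generator of a strongly stable semigroup $(e^{At})_{t\ge0}$ on a Banach space $X$, and define $$\varphi(t,x_0,u):=e^{A\left(\int_0^t\alpha(u(s))\,ds\right)}x_0\qquad((t,x_0,u)\in\mathbb{R}^+_0\times X\times\mathcal{U}).$$ Then $\mathfrak{S}:=(X,\mathcal{U},\varphi)$ is a dynamical system with inputs which is weakly input-to-state stable but not strongly input-to-state stable.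
   Context: Notation: $\mathbb{R}^+_0=[0,\infty)$; $\|\cdot\|_p$ is the standard norm on $L^p(\mathbb{R}^+_0,\mathbb{R})$ (functions identified when equal almost everywhere). Semigroups are strongly continuous; $e^{Av}$ with $v\ge0$ denotes the semigroup generated by $A$ at time $v$; it is strongly stable if $e^{Av}x_0\to0$ as $v\to\infty$ for every $x_0\in X$. $\mathcal{K}$ is the set of continuous strictly increasing functions $\gamma:\mathbb{R}^+_0\to\mathbb{R}^+_0$ with $\gamma(0)=0$. For functions $u_1,u_2$ on $\mathbb{R}^+_0$ and $\tau\in\mathbb{R}^+_0$, the concatenation $u_1\,\&_\tau u_2$ is defined by $(u_1\,\&_\tau u_2)(t)=u_1(t)$ for $t\in[0,\tau)$ and $=u_2(t-\tau)$ for $t\ge\tau$. Dynamical system with inputs: a triple $\mathfrak{S}=(X,\mathcal{U},\varphi)$, where $X$ is a normed linear space with norm $\|\cdot\|$; $\mathcal{U}$ is a non-empty set of functions $u:\mathbb{R}^+_0\to U$ with values in some set $U$ (here $U=\mathbb{R}$), endowed with a norm $\|\cdot\|_{\mathcal{U}}$ (meaning the restriction to $\mathcal{U}$ of a norm on some linear space containing $\mathcal{U}$; $\mathcal{U}$ itself need not be linear); and $\varphi:\mathbb{R}^+_0\times X\times\mathcal{U}\to X$ is a map, such that: (1) $u(\cdot+\tau)\in\mathcal{U}$ and $\|u(\cdot+\tau)\|_{\mathcal{U}}\le\|u\|_{\mathcal{U}}$ for all $u\in\mathcal{U}$, $\tau\ge0$; (2) $u_1\,\&_\tau u_2\in\mathcal{U}$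 for all $u_1,u_2\in\mathcal{U}$, $\tau\ge0$; (3) $\varphi(0,x_0,u)=x_0$ and $\varphi(t+s,x_0,u)=\varphi(t,\varphi(s,x_0,u),u(\cdot+s))$ for all $(x_0,u)\in X\times\mathcal{U}$, $s,t\ge0$; (4) $\varphi(\cdot,x_0,u):\mathbb{R}^+_0\to X$ is continuous for all $(x_0,u)\in X\times\mathcal{U}$; (5) if $u_1|_{[0,\tau]}=u_2|_{[0,\tau]}$, then $\varphi(\cdot,x_0,u_1)|_{[0,\tau]}=\varphi(\cdot,x_0,u_2)|_{[0,\tau]}$, for all $x_0\in X$, $u_1,u_2\in\mathcal{U}$, $\tau\ge0$. Stability notions for $\mathfrak{S}$: - Uniformly globally stable: there exist $\underline\sigma,\underline\gamma\in\mathcal{K}$ such that $\|\varphi(t,x_0,u)\|\le\underline\sigma(\|x_0\|)+\underline\gamma(\|u\|_{\mathcal{U}})$ for all $(x_0,u)\in X\times\mathcal{U}$, $t\ge0$. - Of weak asymptotic gain: there is $\overline\gamma\in\mathcal{K}\cup\{0\}$ such that for every $\varepsilon>0$ and $(x_0,u)\in X\times\mathcal{U}$ there is $\overline\tau(\varepsilon,x_0,u)\in\mathbb{R}^+_0$ with $\|\varphi(t,x_0,u)\|\le\varepsilon+\overline\gamma(\|u\|_{\mathcal{U}})$ for all $t\ge\overline\tau(\varepsilon,x_0,u)$. - Of strong asymptotic gain: there is $\overline\gamma\in\mathcal{K}\cup\{0\}$ such that for every $\varepsilon>0$ and $x_0\in X$ there is $\overline\tau(\varepsilon,x_0)\in\mathbb{R}^+_0$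 with $\|\varphi(t,x_0,u)\|\le\varepsilon+\overline\gamma(\|u\|_{\mathcal{U}})$ for all $t\ge\overline\tau(\varepsilon,x_0)$ and all $u\in\mathcal{U}$. - Weakly (resp. strongly) input-to-state stable: uniformly globally stable and of weak (resp. strong) asymptotic gain.
   Formalization: The Banach space X is assumed to be nonzero; for X = {0} the map φ is identically 0, so the system is trivially strongly input-to-state stable and the claim as written fails. *)

(* Defs.v *)
From HB Require Import structures.
From mathcomp Require Import all_boot all_order all_algebra.
From mathcomp Require Import all_classical all_reals all_analysis.

Set Implicit Arguments.
Unset Strict Implicit.
Unset Printing Implicit Defensive.

Import Order.TTheory GRing.Theory Num.Theory.
Import numFieldNormedType.Exports.

Local Open Scope classical_set_scope.
Local Open Scope ring_scope.

Definition nnreal {R : realType} : set R := `[0, +oo[%classic.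

Definition classK {R : realType} (g : R -> R) : Prop :=
  [/\ forall r, 0 <= r -> 0 <= g r,
      {within nnreal, continuous g},
      forall r s, 0 <= r -> r < s -> g r < g s
    & g 0 = 0].

Definition classK0 {R : realType} (g : R -> R) : Prop :=
  classK g \/ forall r, 0 <= r -> g r = 0.

(* A function on [0, +oo[ is represented by a function on [R], of which only
   the values at nonnegative arguments matter. *)
Definition shift_input {R : realType} {U : Type} (tau : R) (u : R -> U) : R -> U :=
  fun t => u (t + tau).

Definition concat_input {R : realType} {U : Type} (tau : R) (u1 u2 : R -> U) :
    R -> U :=
  fun t => if t < tau then u1 t else u2 (t - tau).

(* [identified u v] says that [u] and [v] are the same input: equality on
   [0, +oo[ when inputs are plain functions, equality almost everywhere on
   [0, +oo[ when they are elements of a Lebesgue space. *)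
Record input_system (R : realType) (X : normedModType R) (U : Type) :=
  InputSystem {
    identified : (R -> U) -> (R -> U) -> Prop;
    inputs : set (R -> U);
    input_norm : (R -> U) -> R;
    flow : R -> X -> (R -> U) -> X
  }.

Record identification_compatible (R : realType) (X : normedModType R) (U : Type)
    (S : input_system X U) : Prop := {
  identified_nnreal : forall u v, inputs S u ->
    {in nnreal, u =1 v} -> identified S u v;
  identified_inputs : forall u v, inputs S u -> identified S u v -> inputs S v;
  identified_shift : forall u v tau, inputs S u -> identified S u v -> 0 <= tau ->
    identified S (shift_input tau u) (shift_input tau v);
  identified_concat : forall u1 v1 u2 v2 tau, inputs S u1 -> inputs S u2 ->
    identified S u1 v1 -> identified S u2 v2 -> 0 <= tau ->
    identified S (concat_input tau u1 u2) (concat_input tau v1 v2);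
  identified_flow : forall u v t x, inputs S u -> identified S u v -> 0 <= t ->
    flow S t x u = flow S t x v
}.

(* [input_norm] is the restriction to the set of inputs, taken modulo
   identification, of a norm on a linear space [V] containing it by [j]. *)
Definition input_norm_is_norm (R : realType) (X : normedModType R) (U : Type)
    (S : input_system X U) : Prop :=
  exists (V : normedModType R) (j : (R -> U) -> V),
    (forall u v, inputs S u -> inputs S v -> (j u = j v <-> identified S u v)) /\
    (forall u, inputs S u -> input_norm S u = `|j u|).

Record dynamical_system_with_inputs (R : realType) (X : normedModType R)
    (U : Type) (S : input_system X U) : Prop := {
  dsi_nonempty : inputs S !=set0;
  dsi_identified : identification_compatible S;
  dsi_norm : input_norm_is_norm S;
  dsi_shift : forall u tau, inputs S u -> 0 <= tau ->
    inputs S (shift_input tau u) /\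
    input_norm S (shift_input tau u) <= input_norm S u;
  dsi_concat : forall u1 u2 tau, inputs S u1 -> inputs S u2 -> 0 <= tau ->
    inputs S (concat_input tau u1 u2);
  dsi_flow0 : forall x u, inputs S u -> flow S 0 x u = x;
  dsi_cocycle : forall x u s t, inputs S u -> 0 <= s -> 0 <= t ->
    flow S (t + s) x u = flow S t (flow S s x u) (shift_input s u);
  dsi_continuous : forall x u, inputs S u ->
    {within nnreal, continuous (fun t => flow S t x u)};
  dsi_causal : forall x u1 u2 tau, inputs S u1 -> inputs S u2 -> 0 <= tau ->
    {in `[0, tau], u1 =1 u2} ->
    {in `[0, tau], (fun t => flow S t x u1) =1 (fun t => flow S t x u2)}
}.

Section Stability.
Context (R : realType) (X : normedModType R) (U : Type) (S : input_system X U).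

Definition uniformly_globally_stable : Prop :=
  exists sigma gamma : R -> R, [/\ classK sigma, classK gamma &
    forall x u t, inputs S u -> 0 <= t ->
      `|flow S t x u| <= sigma `|x| + gamma (input_norm S u)].

Definition weak_asymptotic_gain : Prop :=
  exists gamma : R -> R, classK0 gamma /\
    forall eps, 0 < eps -> forall x u, inputs S u ->
      exists tau, 0 <= tau /\ forall t, tau <= t ->
        `|flow S t x u| <= eps + gamma (input_norm S u).

Definition strong_asymptotic_gain : Prop :=
  exists gamma : R -> R, classK0 gamma /\
    forall eps, 0 < eps -> forall x,
      exists tau, 0 <= tau /\ forall t u, tau <= t -> inputs S u ->
        `|flow S t x u| <= eps + gamma (input_norm S u).

Definition weakly_input_to_state_stable : Prop :=
  uniformly_globally_stable /\ weak_asymptotic_gain.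

Definition strongly_input_to_state_stable : Prop :=
  uniformly_globally_stable /\ strong_asymptotic_gain.

End Stability.

Section Semigroups.
Context (R : realType) (X : normedModType R).
Implicit Type T : R -> X -> X.

(* [T t] is arbitrary for [t < 0]. *)
Record strongly_continuous_semigroup T : Prop := {
  scs_linear : forall t, 0 <= t -> linear (T t);
  scs_continuous : forall t, 0 <= t -> continuous (T t);
  scs_0 : forall x, T 0 x = x;
  scs_D : forall s t x, 0 <= s -> 0 <= t -> T (s + t) x = T s (T t x);
  scs_cvg : forall x, T h x @[h --> 0^'+] --> x
}.

(* The (in general unbounded) operator [A] with domain [domA] is the
   infinitesimal generator of [T], that is, [T t] is [e^{At}]. The values of
   [A] outside [domA] are irrelevant. *)
Definition generates (domA : set X) (A : X -> X) T : Prop :=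
  strongly_continuous_semigroup T /\
  forall x y, (domA x /\ A x = y) <->
    h^-1 *: (T h x - x) @[h --> 0^'+] --> y.

Definition strongly_stable T : Prop :=
  forall x, T v x @[v --> +oo] --> (0 : X).

End Semigroups.

Section LebesgueInputs.
Context {R : realType}.

(* The completed measure is used because [alpha] is not assumed to be Borel,
   so [alpha \o u] can at best be asked to be Lebesgue measurable. *)
Local Notation mu := (@completed_lebesgue_measure R).

Definition locally_integrable_nnreal (f : R -> R) : Prop :=
  forall K : set R, compact K -> K `<=` nnreal -> mu.-integrable K (EFin \o f).

(* [0, +oo[ is embedded in [R] by extending functions by zero. *)
Definition Lp_nnreal (p : \bar R) : set (R -> R) :=
  [set u | (u \_ nnreal) \in Lfun mu p].

Definition Lp_norm_nnreal (p : \bar R) (u : R -> R) : R :=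
  fine ('N[mu]_p [EFin \o (u \_ nnreal)])%E.

Definition ae_eq_nnreal (u v : R -> R) : Prop :=
  {ae mu, forall t, nnreal t -> u t = v t}.

Definition divergent_inputs (p : \bar R) (alpha : R -> R) : set (R -> R) :=
  [set u | [/\ Lp_nnreal p u, locally_integrable_nnreal (alpha \o u) &
    (\int[mu]_(s in nnreal) (alpha (u s))%:E = +oo)%E]].

Definition time_changed_system (X : normedModType R) (p : \bar R)
    (alpha : R -> R) (T : R -> X -> X) : input_system X R :=
  {| identified := ae_eq_nnreal;
     inputs := divergent_inputs p alpha;
     input_norm := Lp_norm_nnreal p;
     flow := fun t x u => T (\int[mu]_(s in `[0, t]) alpha (u s)) x |}.

End LebesgueInputs.

(* Main.v *)
Require Import Defs.
From HB Require Import structures.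
From mathcomp Require Import all_boot all_order all_algebra.
From mathcomp Require Import all_classical all_reals all_analysis.
From mathcomp Require Import measurable_realfun ess_sup_inf.

Set Implicit Arguments.
Unset Strict Implicit.
Unset Printing Implicit Defensive.

Import Order.TTheory GRing.Theory Num.Theory.
Import numFieldNormedType.Exports.

Local Open Scope classical_set_scope.
Local Open Scope ring_scope.

(** The trajectory of [x] under the input [u] is the orbit of [x] under the
semigroup, read on the clock that shows [G t = \int_0^t alpha (u s) ds] at
time [t]. As [alpha] is nonnegative and [alpha \o u] is locally integrable
with infinite integral, this clock is continuous, starts at [0], never runs
backwards and is unbounded.

Hence every trajectory is a slowed down or accelerated complete orbit. By
strong stability it tends to [0], whatever the input ([primitive_diverges]):
the system has the weak asymptotic gain [0]. A strongly stable semigroup is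
moreover bounded, by two applications of the uniform boundedness principle
([semigroup_locally_bounded], [semigroup_bounded]), which gives uniform global
stability.

The speed of the clock is however not controlled by the norm of the input. As
[alpha 0 = 0], preceding [u] by the zero input on [[0, tau[] stops the clock
until [tau], so that the state remains equal to [x] there, while the L^p norm
is at most that of [u] ([Lp_norm_delay]). A gain [gamma] that is uniform in the input
would therefore give [|x| <= 1 + gamma |u|] for one fixed [u] and every [x],
which is absurd in a nonzero space.

It remains to see that this is a dynamical system. Its cocycle property is the
additivity of the clock ([primitive_shift]), its continuity is the absolute
continuity of the integral ([primitive_continuous]) joined to the uniform
continuity of orbits ([semigroup_continuous]). The set of inputs is stable
under shifts and concatenations because the completed Lebesgue measure is
invariant under translations, which is proved on the outer measure
([completed_shift]) and then transported to integrals, null sets and L^p norms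
by general facts on measure preserving maps. The L^p norm is a norm on classes
of inputs by passing to the quotient of a seminormed space
([seminorm_quotientP]). Finally, [(1 + t)^-1] and, for [p = 1], [(1 + t)^-2]
are examples of inputs. *)

(** * Measure preserving maps and translations of the completed Lebesgue measure *)

Section LnormMonotone.
Context d (T : measurableType d) (R : realType) (mu : {measure set T -> \bar R}).

Lemma measurable_abse_poweR (f : T -> R) (r : R) : measurable_fun [set: T] f ->
  measurable_fun [set: T] (fun x => poweR `|(f x)%:E| r).
Proof.
move=> mf; apply: (@measurableT_comp _ _ _ _ _ _ (fun x => poweR `|x| r)).
  exact: (measurableT_comp (measurable_poweR r)).
exact/measurable_EFinP.
Qed.

(** For finite [p] both the power and the root are monotone on nonnegative
numbers; for [p = +oo] an essential upper bound of [g] is one of [f]. *)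
Lemma ae_le_Lnorm (p : \bar R) (f g : T -> R) : (0 < p)%E ->
  measurable_fun [set: T] f -> measurable_fun [set: T] g ->
  {ae mu, forall x, `|f x| <= `|g x|} ->
  ('N[mu]_p[EFin \o f] <= 'N[mu]_p[EFin \o g])%E.
Proof.
move=> p0 mf mg fg; rewrite !Lnorm.unlock.
move: p p0 => [r p0|_|//].
- have mono : {homo (fun x : \bar R => poweR `|x| r) :
      x y / (`|x| <= `|y|)%E >-> (x <= y)%E}.
    move=> x y xy; apply: gt0_ler_poweR => //; last 2 first.
    + by rewrite in_itv/= abse_ge0 leey.
    + by rewrite in_itv/= abse_ge0 leey.
    + by rewrite ltW // -lte_fin.
  apply: gt0_ler_poweR.
  + by rewrite invr_ge0 ltW // -lte_fin.
  + by rewrite in_itv/= leey andbT integral_ge0// => x _; exact: poweR_ge0.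
  + by rewrite in_itv/= leey andbT integral_ge0// => x _; exact: poweR_ge0.
  apply: ae_ge0_le_integral => //.
  + by move=> x _; exact: poweR_ge0.
  + exact: measurable_abse_poweR.
  + by move=> x _; exact: poweR_ge0.
  + exact: measurable_abse_poweR.
  + by apply: filterS fg => x fgx _; apply: mono; rewrite lee_fin.
- case: ifPn => // _; apply: le_ess_sup.
  by apply: filterS fg => x /=; rewrite lee_fin.
Qed.

End LnormMonotone.

Section MeasurePreserving.
Context d1 (T1 : measurableType d1) d2 (T2 : measurableType d2) (R : realType).
Variables (mu1 : {measure set T1 -> \bar R}) (mu2 : {measure set T2 -> \bar R}).
Variable phi : T1 -> T2.
Hypothesis mphi : measurable_fun [set: T1] phi.
Hypothesis mu_phi : forall A, measurable A -> mu1 (phi @^-1` A) = mu2 A.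

Let measurable_preimage (D : set T2) : measurable D -> measurable (phi @^-1` D).
Proof. by move=> mD; have := mphi measurableT mD; rewrite setTI. Qed.

Lemma measurable_fun_preserving d' (Y : measurableType d') (D : set T2) (f : T2 -> Y) :
  measurable D -> measurable_fun D f ->
  measurable_fun (phi @^-1` D) (f \o phi).
Proof.
move=> mD mf; apply: (measurable_comp mD) => //.
  by move=> _ [x Dx <-].
exact: measurable_funTS.
Qed.

(** The two spaces are allowed to differ because, besides translations, this is
used for the identity from the completed to the Borel sigma-algebra. *)
Lemma ge0_integral_preserving (D : set T2) (f : T2 -> \bar R) :
  measurable D -> measurable_fun D f -> (forall x, D x -> (0 <= f x)%E) ->
  (\int[mu2]_(x in D) f x = \int[mu1]_(x in phi @^-1` D) f (phi x))%E.
Proof.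
move=> mD mf f0; rewrite -(ge0_integral_pushforward mphi)//.
  by apply: eq_measure_integral => A mA _; rewrite /= /pushforward mu_phi.
by move=> x /[!inE]; exact: f0.
Qed.

Lemma integrable_preserving (D : set T2) (f : T2 -> \bar R) :
  measurable D -> mu2.-integrable D f ->
  mu1.-integrable (phi @^-1` D) (f \o phi).
Proof.
move=> mD /integrableP[mf foo]; apply/integrableP; split.
  exact: measurable_fun_preserving.
by rewrite -(@ge0_integral_preserving D (fun x => `|f x|)%E)//; exact: measurableT_comp.
Qed.

Lemma negligible_preserving (N : set T2) :
  mu2.-negligible N -> mu1.-negligible (phi @^-1` N).
Proof.
move=> [A [mA A0 NA]]; exists (phi @^-1` A); split.
- exact: measurable_preimage.
- by rewrite mu_phi.
- by move=> x /NA.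
Qed.

(** For finite [p] this is a change of variables. For [p = +oo] the preimage of
a null set is null, so an essential upper bound of [f] is one of [f \o phi]. *)
Lemma Lnorm_preserving_le (p : \bar R) (f : T2 -> R) : (0 < p)%E ->
  measurable_fun [set: T2] f ->
  ('N[mu1]_p[EFin \o (f \o phi)] <= 'N[mu2]_p[EFin \o f])%E.
Proof.
move=> p0 mf; rewrite !Lnorm.unlock; move: p p0 => [r _|_|//].
- have := ge0_integral_preserving measurableT (measurable_abse_poweR r mf)
    (fun x _ => poweR_ge0 _ r).
  by rewrite preimage_setT /= => ->.
- rewrite -(mu_phi measurableT) preimage_setT.
  case: ifPn => // _; apply/ess_supP.
  have := ess_sup_ge mu2 (abse \o (EFin \o f)).
  exact: negligible_preserving.
Qed.

End MeasurePreserving.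

Section CompletedLebesgue.
Context {R : realType}.
Local Notation mu := (@completed_lebesgue_measure R).
Local Notation LR := (caratheodory_type ((wlength (@idfun R))^*)%mu).

(** The completed Lebesgue measure is the restriction of an outer measure that is
defined on every set by covers. Translating a cover of [A] by half-open
intervals yields a cover of the preimage of [A] with the same lengths. *)
Lemma completed_shift_le (s : R) (A : set R) :
  (mu ((fun x => x + s)%R @^-1` A) <= mu A)%E.
Proof.
rewrite /completed_lebesgue_measure /=.
apply: ereal_inf_le_tmp => _ [F [mF AF] <-].
have preim a b : (fun x => x + s) @^-1` `]a, b]%classic =
    `](a - s), (b - s)]%classic.
  by apply/seteqP; split => x /=; rewrite !in_itv/= ltrBlDr lerBrDr.
exists (fun k => (fun x => x + s) @^-1` F k).
  split; last by move=> x /AF[k _ Fk]; exists k.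
  move=> k; have [[a b] _ /= Fk] := mF k.
  by exists (a - s, b - s) => //=; rewrite -Fk preim.
apply: eq_eseriesr => k _; have [[a b] _ /= Fk] := mF k.
rewrite -Fk preim !wlength_itv /= !lte_fin ltrD2r.
by case: ifPn => // _; rewrite -!EFinB opprB addrA addrNK.
Qed.

Lemma completed_shift (s : R) (A : set R) :
  mu ((fun x => x + s) @^-1` A) = mu A.
Proof.
apply/eqP; rewrite eq_le completed_shift_le /=.
have := completed_shift_le (- s) ((fun x => x + s) @^-1` A).
by rewrite -comp_preimage (_ : _ \o _ = id)//; apply/funext => x /=; rewrite addrNK.
Qed.

(** Caratheodory's criterion for the preimage of [B], tested on a set, is the
criterion for [B] tested on the translate of that set. *)
Lemma measurable_shift (s : R) :
  measurable_fun [set: LR] ((fun x => x + s) : LR -> LR).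
Proof.
move=> _ B mB; rewrite setTI.
have {}mB (X : set R) : mu X = (mu (X `&` B) + mu (X `&` ~` B))%E := mB X.
pose S : R -> R := fun x => x + s.
suff : forall X : set R, mu X = (mu (X `&` (S @^-1` B)) +
    mu (X `&` ~` (S @^-1` B)))%E by [].
move=> X; have -> : X = S @^-1` ((fun x : R => x - s) @^-1` X).
  by rewrite -comp_preimage (_ : _ \o _ = id)//; apply/funext => x /=; rewrite addrK.
by rewrite preimage_setC -!preimage_setI !(completed_shift s).
Qed.

Lemma borel_completed (A : set R) : measurable A ->
  measurable (A : set LR).
Proof. exact: sub_caratheodory. Qed.

End CompletedLebesgue.

(** * Primitives of locally integrable functions *)

Lemma ge0_integral_splitD d (T : measurableType d) (R : realType)
    (mu : {measure set T -> \bar R}) (A B : set T) (f : T -> \bar R) :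
  measurable A -> measurable B -> A `<=` B -> measurable_fun B f ->
  (forall x, B x -> (0 <= f x)%E) ->
  (\int[mu]_(x in B) f x = \int[mu]_(x in A) f x + \int[mu]_(x in B `\` A) f x)%E.
Proof.
move=> mA mB AB mf f0; rewrite -{1}(setDUK AB) ge0_integral_setU//.
- exact: measurableD.
- by rewrite setDUK.
- by rewrite setDUK.
- by rewrite disj_set2E setDIK.
Qed.

Lemma nnrealE (R : realType) (x : R) : nnreal x = (0 <= x) :> Prop.
Proof. by rewrite /nnreal /= in_itv/= andbT. Qed.

Lemma nnreal_bigcup (R : realType) :
  nnreal = \bigcup_(n : nat) `[0, n%:R]%classic :> set R.
Proof.
apply/seteqP; split => x; rewrite nnrealE.
  move=> x0; exists (Num.truncn x).+1 => //=.
  by rewrite in_itv/= x0/= ltW// Num.Theory.truncnS_gt.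
by move=> [n _ /=]; rewrite in_itv/= => /andP[].
Qed.

Section CompletedIntegral.
Context {R : realType}.
Local Notation mu := (@completed_lebesgue_measure R).
Local Notation LR := (caratheodory_type ((wlength (@idfun R))^*)%mu).

Lemma completed_measurable_itv (i : interval R) : measurable ([set` i] : set LR).
Proof. by apply: borel_completed; exact: measurable_itv. Qed.

Lemma measurable_nnreal : measurable (nnreal : set LR).
Proof. exact: completed_measurable_itv. Qed.

(** A compact subset of [[0, +oo[] is contained in some [[0, b]]. *)
Lemma locally_integrableP (f : R -> R) :
  locally_integrable_nnreal f <->
  forall b, mu.-integrable `[0, b]%classic (EFin \o f).
Proof.
split=> [lf b|lf K cK K0].
  apply: lf; first exact: segment_compact.
  by move=> x /=; rewrite nnrealE in_itv/= => /andP[].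
have [M [_ /(_ (M + 1))]] := compact_bounded cK.
rewrite ltrDl ltr01 => /(_ isT) KM.
apply: integrableS (lf (M + 1)).
- exact: completed_measurable_itv.
- by apply: borel_completed; exact: compact_measurable.
- move=> x Kx; have := K0 _ Kx; rewrite nnrealE /= in_itv/= => ->/=.
  by rewrite (le_trans (ler_norm x))// KM.
Qed.

Lemma measurable_locally_integrable (f : R -> R) : locally_integrable_nnreal f ->
  measurable_fun (nnreal : set LR) f.
Proof.
move/locally_integrableP => lf.
rewrite nnreal_bigcup; apply/measurable_fun_bigcup => n.
  exact: completed_measurable_itv.
by have /measurable_int/measurable_EFinP := lf n%:R.
Qed.

Lemma completed_set1 (x : R) : mu [set x] = 0%E.
Proof. exact: lebesgue_measure_set1. Qed.

Section Primitive.
Variable f : R -> R.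
Hypotheses (f0 : forall x, 0 <= f x) (lf : locally_integrable_nnreal f).
Local Notation G t := (\int[mu]_(s in `[0, t]) f s).

Lemma measurable_nnrealS (D : set R) : measurable (D : set LR) ->
  D `<=` nnreal -> measurable_fun (D : set LR) (EFin \o f).
Proof.
move=> mD D0; apply/measurable_EFinP.
exact: (measurable_funS measurable_nnreal D0 (measurable_locally_integrable lf)).
Qed.

Lemma primitiveE (t : R) : (G t)%:E = (\int[mu]_(s in `[0%R, t]) (f s)%:E)%E.
Proof.
rewrite fineK//; apply: integrable_fin_num; first exact: completed_measurable_itv.
exact: (locally_integrableP f).1 lf t.
Qed.

Lemma primitive0 : G 0 = 0.
Proof.
apply: EFin_inj; rewrite primitiveE set_itv1.
apply: null_set_integral.
- by rewrite -set_itv1; exact: completed_measurable_itv.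
- exact: measurable_fun_set1.
- exact: completed_set1.
Qed.

Lemma primitive_split (s t : R) : 0 <= s -> s <= t ->
  G t = G s + \int[mu]_(r in `]s, t]) f r.
Proof.
move=> s0 st; have U : `[0, s] `|` `]s, t] = `[0, t]%classic.
  by rewrite -itv_bndbnd_setU// bnd_simp.
rewrite -U Rintegral_setU//.
- exact: completed_measurable_itv.
- exact: completed_measurable_itv.
- by rewrite U; exact: (locally_integrableP f).1 lf t.
- rewrite disj_set2E; apply/eqP/seteqP; split => // x /=; rewrite !in_itv/=.
  by move=> [/andP[_ xs] /andP[sx _]]; move: sx; rewrite ltNge xs.
Qed.

Lemma primitive_le (s t : R) : 0 <= s -> s <= t -> G s <= G t.
Proof.
by move=> s0 st; rewrite (primitive_split s0 st) lerDl; exact: Rintegral_ge0.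
Qed.

(** The integral over []s, t + s]] is that over [[s, t + s]], as a point is a null
set, and the latter interval is a translate of [[0, t]]. *)
Lemma primitive_shift (s t : R) : 0 <= s -> 0 <= t ->
  G (t + s) = G s + \int[mu]_(r in `[0, t]) f (r + s).
Proof.
move=> s0 t0; rewrite (@primitive_split s (t + s) s0); last by rewrite lerDr.
congr (_ + fine _).
have pre : (fun x : R => x + s) @^-1` `[s, t + s] = `[0, t]%classic.
  by apply/seteqP; split => x /=; rewrite !in_itv/= lerDr lerD2r.
have mf : measurable_fun (`[s, t + s]%classic : set LR) (EFin \o f).
  apply: measurable_nnrealS; first exact: completed_measurable_itv.
  by move=> x; rewrite nnrealE /= in_itv/= => /andP[/(le_trans s0)].
have f0' (x : R) : `[s, t + s]%classic x -> (0 <= (EFin \o f) x)%E.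
  by move=> _; rewrite lee_fin.
have := ge0_integral_preserving (measurable_shift s)
  (fun A _ => completed_shift s A) (completed_measurable_itv _) mf f0'.
rewrite pre => <-.
rewrite (ge0_negligible_integral _ _ mf f0' (completed_set1 s))//.
- by rewrite setDitv1l.
- by rewrite -set_itv1; exact: completed_measurable_itv.
- exact: completed_measurable_itv.
Qed.

(** Absolute continuity of the integral of [f] over [[0, b]]. *)
Lemma primitive_continuous (b e : R) : 0 < e ->
  exists2 d, 0 < d & forall s t, 0 <= s -> s <= t -> t <= b -> t - s < d ->
    G t - G s < e.
Proof.
move=> e0.
pose g : LR -> R := f \_ `[0, b].
have ig : mu.-integrable [set: LR] (EFin \o g).
  have := (locally_integrableP f).1 lf b.
  move/(integrable_mkcond _ (completed_measurable_itv _)).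
  by rewrite /g restrict_EFin.
have [d [d0 H]] := integral_normr_continuous ig e0.
exists d => // s t s0 st tb tsd.
rewrite (primitive_split s0 st) addrAC subrr add0r.
have muA : (mu `]s, t]%classic < d%:E)%E.
  rewrite [mu _](_ : _ = lebesgue_measure `]s, t]%classic)//.
  rewrite lebesgue_measure_itv/= lte_fin.
  by case: ifPn => _; rewrite ?lte_fin// -EFinB lte_fin.
apply: le_lt_trans (H _ (completed_measurable_itv _) muA).
rewrite le_eqVlt; apply/orP; left; apply/eqP; apply: eq_Rintegral => x.
rewrite inE /= in_itv/= /g patchE => /andP[sx xt].
rewrite mem_set ?ger0_norm//= in_itv/=.
by rewrite (le_trans s0 (ltW sx)) (le_trans xt).
Qed.

(** By monotone convergence the integrals over the intervals [[0, n]] tend to the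
integral over the half-line; for other end points the primitive is monotone. *)
Lemma primitive_diverges : (\int[mu]_(s in nnreal) (f s)%:E = +oo)%E ->
  forall M, exists2 t, 0 <= t & forall t', t <= t' -> M <= G t'.
Proof.
move=> foo M.
have := @ge0_nondecreasing_set_cvg_integral _ LR R
  (fun n : nat => `[0, n%:R]%classic) (EFin \o f) mu.
rewrite -nnreal_bigcup => /(_ _ _ _ _)/wrap[].
- move=> m n mn; apply/subsetPset => x /=; rewrite !in_itv/= => /andP[->]/=.
  by move=> /le_trans; apply; rewrite ler_nat.
- by move=> n; exact: completed_measurable_itv.
- move=> n; apply: measurable_nnrealS; first exact: completed_measurable_itv.
  by move=> x; rewrite nnrealE /= in_itv/= => /andP[].
- by move=> n x _; rewrite lee_fin.
rewrite [X in _ --> X]foo => /cvgeyPge/(_ M) [n _ Hn].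
exists n%:R => // t nt.
have := Hn n (leqnn n); rewrite /= -[leRHS]primitiveE lee_fin => /le_trans; apply.
exact: primitive_le.
Qed.

End Primitive.

End CompletedIntegral.

(** * Shifts and concatenations of functions on the half-line *)

Section CompleteMeasure.
Context d (T : measurableType d) (R : realType) (mu : {measure set T -> \bar R}).

(** Upward closure of the filter of almost everywhere true properties. It is
stated over an abstract measurable type because the instance of the filter is
not inferred on the type that carries the completed Lebesgue measure. *)
Lemma ae_weaken (P Q : T -> Prop) : {ae mu, forall x, P x} ->
  (forall x, P x -> Q x) -> {ae mu, forall x, Q x}.
Proof. by move=> aeP PQ; exact: filterS aeP. Qed.

Lemma ae_measurable (f g : T -> R) (D : set T) : measure_is_complete mu ->
  {ae mu, forall x, D x -> f x = g x} ->
  measurable_fun D f -> measurable_fun D g.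
Proof.
move=> cmu fg /measurable_EFinP mf; apply/measurable_EFinP.
have fgE : ae_eq mu D (EFin \o f) (EFin \o g).
  by apply: filterS fg => x /[apply] /= ->.
exact: (ae_measurable_fun cmu fgE mf).
Qed.

Lemma ae_integrable (f g : T -> R) (D : set T) : measure_is_complete mu ->
  measurable D ->
  {ae mu, forall x, D x -> f x = g x} ->
  mu.-integrable D (EFin \o f) -> mu.-integrable D (EFin \o g).
Proof.
move=> cmu mD fg /integrableP[mf ff]; apply/integrableP.
have mg : measurable_fun D (EFin \o g).
  by move/measurable_EFinP : mf => /(ae_measurable cmu fg)/measurable_EFinP.
split => //.
suff <- : (\int[mu]_(x in D) `|(f x)%:E| = \int[mu]_(x in D) `|(g x)%:E|)%E.
  exact: ff.
apply: ge0_ae_eq_integral => //; [exact: measurableT_comp..|].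
by apply: filterS fg => x /[apply] ->.
Qed.

Lemma integrable_setU (A B : set T) (f : T -> \bar R) :
  measurable A -> measurable B -> mu.-integrable A f -> mu.-integrable B f ->
  mu.-integrable (A `|` B) f.
Proof.
move=> mA mB /integrableP[mfA fA] /integrableP[mfB fB]; apply/integrableP.
have mf : measurable_fun (A `|` B) f by apply/measurable_funU.
split => //.
rewrite (ge0_integral_splitD _ mA (measurableU _ _ mA mB))//; last first.
  exact: measurableT_comp.
rewrite lte_add_pinfty// (le_lt_trans _ fB)//; apply: ge0_subset_integral => //.
- by apply: measurableD => //; exact: measurableU.
- exact: measurableT_comp.
- by move=> x [[]].
Qed.

End CompleteMeasure.

Section LfunClosure.
Context d (T : measurableType d) (R : realType) (mu : {measure set T -> \bar R}).
Variable p : \bar R.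
Hypothesis p0 : (0 < p)%E.

Lemma LfunE (f : T -> R) : (f \in Lfun mu p) <->
  (measurable_fun [set: T] f /\ ('N[mu]_p[EFin \o f] < +oo)%E).
Proof.
split=> [/andP[]|[mf ff]]; first by rewrite !inE.
by apply/andP; rewrite !inE.
Qed.

Lemma Lfun_le (f g : T -> R) : f \in Lfun mu p -> measurable_fun [set: T] g ->
  (forall x, `|g x| <= `|f x|) -> g \in Lfun mu p.
Proof.
move=> /LfunE[mf ff] mg gf; apply/LfunE; split => //.
apply: le_lt_trans ff; apply: ae_le_Lnorm => //.
exact: aeW.
Qed.

Lemma Lfun_restrict (f : T -> R) (D : set T) : measurable D ->
  f \in Lfun mu p -> f \_ D \in Lfun mu p /\
  ('N[mu]_p[EFin \o (f \_ D)] <= 'N[mu]_p[EFin \o f])%E.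
Proof.
move=> mD Lf; have [mf _] := (LfunE _).1 Lf.
have mfD : measurable_fun [set: T] (f \_ D).
  by apply/(measurable_restrictT _ mD); exact: measurable_funTS.
have le x : `|(f \_ D) x| <= `|f x|.
  by rewrite patchE; case: ifPn => // _; rewrite normr0.
split; first exact: Lfun_le le.
by apply: ae_le_Lnorm => //; exact: aeW.
Qed.

Lemma Lfun_preserving (phi : T -> T) (f : T -> R) :
  measurable_fun [set: T] phi ->
  (forall A, measurable A -> mu (phi @^-1` A) = mu A) ->
  f \in Lfun mu p -> f \o phi \in Lfun mu p.
Proof.
move=> mphi mu_phi /LfunE[mf ff]; apply/LfunE; split.
  exact: measurableT_comp.
by apply: le_lt_trans ff; exact: Lnorm_preserving_le.
Qed.

Lemma ae_Lnorm (f g : T -> R) :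
  measurable_fun [set: T] f -> measurable_fun [set: T] g ->
  {ae mu, forall x, f x = g x} ->
  ('N[mu]_p[EFin \o f] = 'N[mu]_p[EFin \o g])%E.
Proof.
by move=> mf mg fg; apply/eqP; rewrite eq_le !ae_le_Lnorm//;
  apply: filterS fg => x ->.
Qed.

Lemma ae_Lfun (f g : T -> R) : measure_is_complete mu ->
  {ae mu, forall x, f x = g x} -> f \in Lfun mu p -> g \in Lfun mu p.
Proof.
move=> cmu fg /LfunE[mf ff]; have mg : measurable_fun [set: T] g.
  by apply: (ae_measurable cmu _ mf); apply: filterS fg => x.
by apply/LfunE; split => //; rewrite -(ae_Lnorm mf).
Qed.

End LfunClosure.

Section HalfLineInputs.
Context {R : realType}.
Local Notation mu := (@completed_lebesgue_measure R).
Local Notation LR := (caratheodory_type ((wlength (@idfun R))^*)%mu).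
Implicit Types (p : \bar R) (u v f : R -> R).

Lemma ae_eq_restrict u v : ae_eq_nnreal u v ->
  {ae mu, forall x, (u \_ nnreal) x = (v \_ nnreal) x}.
Proof.
move=> uv; apply: (ae_weaken uv) => x {}uv; rewrite !patchE; case: ifPn => //.
by rewrite inE => /uv.
Qed.

Lemma ae_Lp_nnreal p u v : (0 < p)%E -> ae_eq_nnreal u v ->
  Lp_nnreal p u -> Lp_nnreal p v.
Proof.
move=> p0 uv; apply: (ae_Lfun p0 completed_lebesgue_measure_is_complete).
exact: ae_eq_restrict.
Qed.

Lemma restrict_shift tau u : 0 <= tau ->
  shift_input tau u \_ nnreal = ((u \_ nnreal) \o (fun x => x + tau)) \_ nnreal.
Proof.
move=> tau0; apply/funext => x; rewrite !patchE; case: ifPn => //.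
rewrite inE nnrealE => x0; rewrite /= patchE mem_set//.
by rewrite nnrealE addr_ge0.
Qed.

Lemma Lp_shift p u tau : (0 < p)%E -> 0 <= tau -> Lp_nnreal p u ->
  Lp_nnreal p (shift_input tau u) /\
  Lp_norm_nnreal p (shift_input tau u) <= Lp_norm_nnreal p u.
Proof.
move=> p0 tau0 Lu.
have Lut := Lfun_preserving p0 (measurable_shift tau)
  (fun A _ => completed_shift tau A) Lu.
have [Ls le] := Lfun_restrict p0 measurable_nnreal Lut.
rewrite -restrict_shift// in Ls le.
split; first exact: Ls.
have [mu_ fu] := (LfunE _ _ _).1 Lu; have [_ fs] := (LfunE _ _ _).1 Ls.
rewrite fine_le//; [by rewrite ge0_fin_numE// Lnorm_ge0..|].
exact: le_trans le (Lnorm_preserving_le (measurable_shift tau)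
  (fun A _ => completed_shift tau A) p0 mu_).
Qed.

(** Before [tau] only the first summand can be nonzero, from [tau] on only the
second one. *)
Lemma restrict_concat tau u1 u2 : 0 <= tau ->
  concat_input tau u1 u2 \_ nnreal =
  u1 \_ `[0, tau[ \+ ((u2 \_ nnreal) \o (fun x => x - tau)).
Proof.
move=> tau0; apply/funext => x /=; rewrite !patchE /concat_input.
rewrite !mem_setE /nnreal !in_itv/= !andbT subr_ge0 ltNge.
have [tx|xt] := leP tau x; last by rewrite andbT addr0.
by rewrite (le_trans tau0 tx) andbF add0r.
Qed.

Lemma Lp_concat p u1 u2 tau : (1 <= p)%E -> 0 <= tau ->
  Lp_nnreal p u1 -> Lp_nnreal p u2 -> Lp_nnreal p (concat_input tau u1 u2).
Proof.
move=> p1 tau0 L1 L2; have p0 : (0 < p)%E by exact: lt_le_trans p1.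
rewrite /Lp_nnreal /= restrict_concat//; apply: (Lfun_addr_closed mu p1).2.
  have -> : u1 \_ `[0, tau[ = (u1 \_ nnreal) \_ `[0, tau[.
    apply/funext => x; rewrite !patchE; case: ifPn => //.
    by rewrite mem_setE in_itv/= => /andP[x0 _]; rewrite mem_set// nnrealE.
  have mD : measurable (`[0, tau[%classic : set LR) := completed_measurable_itv _.
  by have [L _] := Lfun_restrict p0 mD L1; exact: L.
exact: (Lfun_preserving p0 (measurable_shift (- tau))
  (fun A _ => completed_shift (- tau) A) L2).
Qed.

(** Extended by zero to the whole line, the delayed input is a translate of [u]. *)
Lemma Lp_norm_delay p u tau : (0 < p)%E -> 0 <= tau -> Lp_nnreal p u ->
  Lp_norm_nnreal p (concat_input tau (cst 0) u) <= Lp_norm_nnreal p u.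
Proof.
move=> p0 tau0 Lu; have [mu_ fu] := (LfunE _ _ _).1 Lu.
have le := Lnorm_preserving_le (measurable_shift (- tau))
  (fun A _ => completed_shift (- tau) A) p0 mu_.
rewrite /Lp_norm_nnreal restrict_concat//.
have -> : cst 0 \_ `[0, tau[ \+ ((u \_ nnreal) \o (fun x => x - tau)) =
    (u \_ nnreal) \o (fun x => x - tau).
  by apply/funext => x; rewrite /= patchE; case: ifPn; rewrite add0r.
rewrite fine_le//; rewrite ge0_fin_numE ?Lnorm_ge0//.
exact: le_lt_trans fu.
Qed.

Lemma ae_locally_integrable f g : ae_eq_nnreal f g ->
  locally_integrable_nnreal f -> locally_integrable_nnreal g.
Proof.
move=> fg /locally_integrableP lf; apply/locally_integrableP => b.
apply: ae_integrable (lf b).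
- exact: completed_lebesgue_measure_is_complete.
- exact: completed_measurable_itv.
- apply: (ae_weaken fg) => x {}fg /=; rewrite in_itv/= => /andP[x0 _].
  by apply: fg; rewrite nnrealE.
Qed.

Lemma ae_primitive f g t : ae_eq_nnreal f g ->
  locally_integrable_nnreal f -> locally_integrable_nnreal g ->
  \int[mu]_(s in `[0, t]) f s = \int[mu]_(s in `[0, t]) g s.
Proof.
move=> fg lf lg; congr fine.
have /measurable_int mf := (locally_integrableP f).1 lf t.
have /measurable_int mg := (locally_integrableP g).1 lg t.
apply: ae_eq_integral => //; first exact: completed_measurable_itv.
apply: (ae_weaken fg) => x {}fg /=; rewrite in_itv/= => /andP[x0 _].
by rewrite fg// nnrealE.
Qed.

Lemma locally_integrable_shift f tau : 0 <= tau ->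
  locally_integrable_nnreal f -> locally_integrable_nnreal (shift_input tau f).
Proof.
move=> tau0 /locally_integrableP lf; apply/locally_integrableP => b.
have pre : (fun x : R => x + tau) @^-1` `[tau, b + tau] = `[0, b]%classic.
  by apply/seteqP; split => x /=; rewrite !in_itv/= lerDr lerD2r.
rewrite -pre.
apply: (integrable_preserving (measurable_shift tau)
  (fun A _ => completed_shift tau A) (completed_measurable_itv _) (f := EFin \o f)).
apply: integrableS (lf (b + tau)); [exact: completed_measurable_itv..|].
move=> x /=; rewrite !in_itv/= => /andP[tx ->].
by rewrite (le_trans tau0 tx).
Qed.

Lemma locally_integrable_concat f1 f2 tau : 0 <= tau ->
  locally_integrable_nnreal f1 -> locally_integrable_nnreal f2 ->
  locally_integrable_nnreal (concat_input tau f1 f2).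
Proof.
move=> tau0 /locally_integrableP l1 /locally_integrableP l2.
apply/locally_integrableP => b.
apply: (@integrableS _ _ _ mu (`[0, tau[ `|` `[tau, b + tau])).
- by apply: measurableU; exact: completed_measurable_itv.
- exact: completed_measurable_itv.
- move=> x /=; rewrite !in_itv/= => /andP[-> xb].
  have [tx|xt] := leP tau x; last by left.
  by right; rewrite (le_trans xb)// lerDl.
apply: integrable_setU; [exact: completed_measurable_itv..| |].
  apply: (@eq_integrable _ _ _ mu _ _ (EFin \o f1)).
  - exact: completed_measurable_itv.
  - by move=> x; rewrite inE /= in_itv/= /concat_input => /andP[_ ->].
  - apply: integrableS (l1 tau); [exact: completed_measurable_itv..|].
    by move=> x /=; rewrite !in_itv/= => /andP[-> /ltW].
apply: (@eq_integrable _ _ _ mu _ _ (fun x : R => (f2 (x - tau))%:E)).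
- exact: completed_measurable_itv.
- move=> x; rewrite inE /= in_itv/= /concat_input => /andP[tx _].
  by rewrite ltNge tx.
have pre : (fun x : R => x - tau) @^-1` `[0, b] = `[tau, b + tau]%classic.
  by apply/seteqP; split => x /=; rewrite !in_itv/= subr_ge0 lerBlDr.
rewrite -pre.
exact: (integrable_preserving (measurable_shift (- tau))
  (fun A _ => completed_shift (- tau) A) (completed_measurable_itv _) (l2 b)).
Qed.

Section Divergence.
Variables (f : R -> R) (tau : R).
Hypotheses (f0 : forall x, 0 <= f x) (tau0 : 0 <= tau).
Hypothesis lf : locally_integrable_nnreal f.

Lemma integral_nnreal_shift :
  (\int[mu]_(s in `[tau, +oo[) (f s)%:E =
   \int[mu]_(s in nnreal) (shift_input tau f s)%:E)%E.
Proof.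
have mf : measurable_fun (`[tau, +oo[%classic : set LR) (EFin \o f).
  apply: measurable_nnrealS => //; first exact: completed_measurable_itv.
  by move=> x; rewrite nnrealE /= in_itv/= andbT; exact: le_trans.
have f0' (x : R) : `[tau, +oo[%classic x -> (0 <= (EFin \o f) x)%E.
  by move=> _; rewrite lee_fin.
rewrite (ge0_integral_preserving (measurable_shift tau)
  (fun A _ => completed_shift tau A) (completed_measurable_itv _) mf f0').
congr integral; apply/seteqP; split => x; rewrite nnrealE /= in_itv/= andbT.
  by rewrite lerDr.
by rewrite lerDr.
Qed.

(** A locally integrable function has a finite integral over [[0, tau]], so that
the divergence takes place after [tau]. *)
Lemma divergent_shift : (\int[mu]_(s in nnreal) (f s)%:E = +oo)%E ->
  (\int[mu]_(s in nnreal) (shift_input tau f s)%:E = +oo)%E.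
Proof.
move=> foo; rewrite -integral_nnreal_shift.
have mf := measurable_nnrealS lf measurable_nnreal (@subset_refl _ _).
have sub : `[0, tau] `<=` (nnreal : set R).
  by move=> x; rewrite nnrealE /= in_itv/= => /andP[].
have := ge0_integral_splitD mu (completed_measurable_itv `[0, tau])
  measurable_nnreal sub mf (fun x _ => f0 x).
set a := (X in (_ = X + _)%E -> _); set b := (X in (_ = _ + X)%E -> _).
rewrite [X in X = _ -> _]foo => ab.
have afin : a \is a fin_num.
  apply: integrable_fin_num; first exact: completed_measurable_itv.
  exact: (locally_integrableP f).1 lf tau.
apply/eqP; rewrite -leye_eq.
have -> : +oo%E = b.
  by move: ab afin; case: (a) => // r; case: (b).
have mf' : measurable_fun (`[tau, +oo[%classic : set LR) (EFin \o f).
  apply: measurable_nnrealS => //; first exact: completed_measurable_itv.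
  by move=> x; rewrite nnrealE /= in_itv/= andbT; exact: le_trans.
apply: ge0_subset_integral => //.
- by apply: measurableD; [exact: measurable_nnreal|exact: completed_measurable_itv].
- exact: completed_measurable_itv.
- by move=> x _; rewrite lee_fin.
- move=> x [+ /=]; rewrite nnrealE !in_itv/= andbT => -> /negP.
  by rewrite -ltNge => /ltW.
Qed.

End Divergence.

Lemma divergent_concat f1 f2 tau : (forall x, 0 <= f1 x) -> (forall x, 0 <= f2 x) ->
  0 <= tau -> locally_integrable_nnreal f1 -> locally_integrable_nnreal f2 ->
  (\int[mu]_(s in nnreal) (f2 s)%:E = +oo)%E ->
  (\int[mu]_(s in nnreal) (concat_input tau f1 f2 s)%:E = +oo)%E.
Proof.
move=> f10 f20 tau0 l1 l2 foo.
have lc := locally_integrable_concat tau0 l1 l2.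
have c0 x : 0 <= concat_input tau f1 f2 x by rewrite /concat_input; case: ifP.
apply/eqP; rewrite -leye_eq -foo.
have -> : (\int[mu]_(s in nnreal) (f2 s)%:E =
    \int[mu]_(s in nnreal) (shift_input tau (concat_input tau f1 f2) s)%:E)%E.
  apply: eq_integral => x; rewrite inE nnrealE => x0.
  by rewrite /shift_input /concat_input ltNge lerDr x0 addrK.
rewrite -integral_nnreal_shift//; have mI := completed_measurable_itv `[tau, +oo[.
have mc := measurable_nnrealS lc measurable_nnreal (@subset_refl _ _).
apply: (@ge0_subset_integral _ LR R mu _ _ mI measurable_nnreal _ mc).
- by move=> x _; rewrite lee_fin.
- by move=> x; rewrite nnrealE /= in_itv/= andbT; exact: le_trans.
Qed.

Lemma ae_eq_shift u v tau : 0 <= tau -> ae_eq_nnreal u v ->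
  ae_eq_nnreal (shift_input tau u) (shift_input tau v).
Proof.
move=> tau0 uv.
have := negligible_preserving (measurable_shift tau)
  (fun A _ => completed_shift tau A) uv.
apply: negligibleS => t /= H uvt; apply: H; rewrite nnrealE => t0.
by apply: uvt; rewrite nnrealE addr_ge0.
Qed.

Lemma ae_eq_concat u1 v1 u2 v2 tau : ae_eq_nnreal u1 v1 -> ae_eq_nnreal u2 v2 ->
  ae_eq_nnreal (concat_input tau u1 u2) (concat_input tau v1 v2).
Proof.
move=> uv1 uv2.
have uv2' := negligible_preserving (measurable_shift (- tau))
  (fun A _ => completed_shift (- tau) A) uv2.
have := negligibleU uv1 uv2'.
apply: negligibleS => t /= H; apply: contrapT => /not_orP[/contrapT H1 /contrapT H2].
apply: H => t0; rewrite /concat_input; case: ltP => tt; first exact: H1.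
by apply: H2; rewrite nnrealE subr_ge0.
Qed.

End HalfLineInputs.

(** * Bounded semigroups *)

Section SemigroupBound.
Context {R : realType} {X : completeNormedModType R} (T : R -> X -> X).
Hypothesis scs : strongly_continuous_semigroup T.

(** The uniform boundedness principle bounds the images of the unit ball;
homogeneity turns this into a bound on operator norms. *)
Lemma uniformly_bounded_family (I : set R) : (forall t, I t -> 0 <= t) ->
  (forall x, exists M, forall t, I t -> `|T t x| <= M) ->
  exists2 M : R, 0 <= M & forall t x, I t -> `|T t x| <= M * `|x|.
Proof.
move=> I0 ptw.
have lc t (It : I t) : bounded_fun_norm (T t) /\ linear (T t).
  have lT := scs_linear scs (I0 _ It); split => //.
  pose L : {linear X -> X} := HB.pack (T t) (GRing.isLinear.Build _ _ _ _ _ lT).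
  apply/(@bounded_funP _ _ _ L)/linear_bounded_continuous => x.
  exact: (scs_continuous scs (I0 _ It)).
have [_ [t It <-]|x|M HM] := @Banach_Steinhauss R X X [set T t | t in I] _ _ 1.
- exact: lc.
- by have [M HM] := ptw x; exists M => _ [t It <-]; exact: HM.
exists (Num.max M 0) => [|t x It]; first by rewrite le_max lexx orbT.
have [_ lT] := lc _ It.
pose L : {linear X -> X} := HB.pack (T t) (GRing.isLinear.Build _ _ _ _ _ lT).
have [->|x0] := eqVneq x 0.
  by rewrite -[T t]/(L : X -> X) linear0 !normr0 mulr0.
have nx : 0 < `|x| by rewrite normr_gt0.
rewrite -ler_pdivrMr// le_max; apply/orP; left.
have := HM (T t) _ (`|x|^-1 *: x) _.
rewrite -[T t]/(L : X -> X) linearZ !normrZ normfV normr_id mulVf ?gt_eqF// mulrC.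
apply => //.
by exists t.
Qed.

(** The right limit at [0] is the value there, since [T 0] is the identity. *)
Lemma semigroup_near0 (x : X) (e : R) : 0 < e ->
  exists2 d : R, 0 < d & forall h, 0 <= h -> h < d -> `|T h x - x| < e.
Proof.
move=> e0; have /cvgrPdist_lt/(_ e e0) := @scs_cvg _ _ _ scs x.
rewrite near_withinE => /nbhs_ballP[d /= d0 Hd]; exists d => // h h0 hd.
have [<-|h1] := eqVneq 0 h; first by rewrite (scs_0 scs) subrr normr0.
rewrite distrC; apply: Hd; last by rewrite lt_neqAle h1.
by rewrite /ball/= sub0r normrN ger0_norm.
Qed.

(** Otherwise there are times [t n] tending to [0] at which the operator norms are
unbounded. As [T (t n) x] tends to [x], this family is pointwise bounded, and
the uniform boundedness principle gives a contradiction. *)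
Lemma semigroup_locally_bounded :
  exists2 d : R, 0 < d & exists2 M : R, 0 <= M &
    forall t x, 0 <= t -> t <= d -> `|T t x| <= M * `|x|.
Proof.
apply: contrapT => nb.
have bad (n : nat) : exists t, [/\ 0 <= t, t <= n.+1%:R^-1 &
    exists x, n%:R * `|x| < `|T t x|].
  apply: contrapT => ngood; apply: nb; exists n.+1%:R^-1; first by rewrite invr_gt0.
  exists n%:R => // t x t0 tn; rewrite leNgt; apply/negP => Hx.
  by apply: ngood; exists t; split => //; exists x.
have [t Ht] := choice bad.
have [||M M0 HM] := @uniformly_bounded_family (range t).
- by move=> _ [n _ <-]; have [] := Ht n.
- move=> x; have [d d0 Hd] := semigroup_near0 x (@ltr01 R).
  pose N := Num.truncn d^-1.
  exists (`|x| + 1 + \sum_(i < N) `|T (t i) x|) => _ [n _ <-].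
  have [nN|Nn] := ltnP n N.
    rewrite (bigD1 (Ordinal nN))//= addrCA lerDl addr_ge0//.
    by apply: sumr_ge0.
  have [tn0 tn _] := Ht n.
  rewrite ler_wpDr//; first exact: sumr_ge0.
  rewrite -[T (t n) x](subrK x) addrC (le_trans (ler_normD _ _))// lerD2l ltW// Hd//.
  rewrite (le_lt_trans tn)// invf_plt ?posrE//.
  rewrite (lt_le_trans (Num.Theory.truncnS_gt _))// ler_nat.
  by rewrite ltnS.
have [_ _ [x]] := Ht (Num.truncn M).+1.
apply/negP; rewrite -leNgt.
have := HM (t (Num.truncn M).+1) x; move=> /(_ (imageP _ _)) /le_trans; apply => //.
by rewrite ler_wpM2r// ltW// Num.Theory.truncnS_gt.
Qed.

Hypothesis T_stable : strongly_stable T.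

(** Every orbit is bounded: far away because it tends to [0], and before because
[[0, k * d]] is covered by [k] intervals on which the local bound applies. The
uniform boundedness principle makes the bound independent of the orbit. *)
Lemma semigroup_bounded :
  exists2 M : R, 0 <= M & forall t x, 0 <= t -> `|T t x| <= M * `|x|.
Proof.
have [d d0 [C C0 HC]] := semigroup_locally_bounded.
(* [C + 1] instead of [C], as the bound has to increase with [k]. *)
have HC' (k : nat) : forall t x, 0 <= t -> t <= k%:R * d ->
    `|T t x| <= (C + 1) ^+ k * `|x|.
  elim: k => [|k IH] t x t0.
    rewrite mul0r => tle0; have -> : t = 0 by apply/eqP; rewrite eq_le tle0.
    by rewrite (scs_0 scs) expr0 mul1r.
  have C1 : 1 <= C + 1 by rewrite lerDr.
  have [td _|dt tk] := leP t d.
    rewrite (le_trans (HC _ _ t0 td))// ler_wpM2r//.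
    by rewrite (@le_trans _ _ (C + 1)) ?lerDl// ler_eXnr.
  have td0 : 0 <= t - d by rewrite subr_ge0 ltW.
  rewrite -[t](subrK d) addrC (scs_D scs)//; last exact: ltW.
  rewrite (le_trans (HC _ _ (ltW d0) (lexx _)))// exprS -mulrA ler_pM//.
    by rewrite lerDl.
  by apply: IH => //; rewrite lerBlDr -natr1 mulrDl mul1r in tk *.
have [//|x|M M0 HM] := @uniformly_bounded_family [set t | 0 <= t].
  have /cvgrPdist_lt/(_ 1 ltr01) [V [_ HV]] := T_stable x.
  pose k := (Num.truncn (V / d)).+1.
  exists (Num.max 1 ((C + 1) ^+ k * `|x|)) => t /= t0.
  rewrite le_max; have [tV|Vt] := leP t V.
    apply/orP; right; apply: HC' => //.
    rewrite (le_trans tV)// -ler_pdivrMr// ltW// /k; exact: Num.Theory.truncnS_gt.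
  by have := HV _ Vt; rewrite sub0r normrN => /ltW ->.
by exists M.
Qed.

(** With [M] a bound of the semigroup,
[|T t x - T s x| = |T s (T (t - s) x - x)| <= M * |T (t - s) x - x|], and the
right-hand side depends only on [t - s]: the orbit is uniformly continuous. *)
Lemma semigroup_continuous (x : X) (e : R) : 0 < e ->
  exists2 d : R, 0 < d & forall s t, 0 <= s -> s <= t -> t - s < d ->
    `|T t x - T s x| < e.
Proof.
move=> e0; have [M M0 HM] := semigroup_bounded.
have M1 : 0 < M + 1 by rewrite ltr_wpDl.
have [d d0 Hd] := semigroup_near0 x (divr_gt0 e0 M1).
exists d => // s t s0 st tsd.
have ts0 : 0 <= t - s by rewrite subr_ge0.
pose L : {linear X -> X} := HB.pack (T s)
  (GRing.isLinear.Build _ _ _ _ _ (scs_linear scs s0)).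
rewrite -[t in T t](subrK s) [t - s + s]addrC (scs_D scs)//.
have -> : T s (T (t - s) x) - T s x = T s (T (t - s) x - x).
  exact: esym (linearB L _ _).
rewrite (le_lt_trans (HM _ _ s0))//.
rewrite (@le_lt_trans _ _ ((M + 1) * `|T (t - s) x - x|))//.
  by rewrite ler_wpM2r// lerDl.
by rewrite mulrC -ltr_pdivlMr// Hd.
Qed.

End SemigroupBound.

(** * The normed quotient of a seminormed space *)

Section SeminormQuotient.
Local Open Scope quotient_scope.
Context (R : realType) (E : lmodType R) (N : E -> R).
Hypothesis ND : forall x y, N (x + y) <= N x + N y.
Hypothesis NZ : forall a x, N (a *: x) = `|a| * N x.

Definition null_vectors : {pred E} := fun x => N x == 0.

Lemma seminorm0 : N 0 = 0.
Proof. by rewrite -(scale0r 0) NZ normr0 mul0r. Qed.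

Lemma seminormN x : N (- x) = N x.
Proof. by rewrite -scaleN1r NZ normrN1 mul1r. Qed.

Lemma seminorm_ge0 x : 0 <= N x.
Proof.
by have := ND x (- x); rewrite subrr seminorm0 seminormN -mulr2n pmulrn_lge0.
Qed.

Lemma null_vectors_zmod_closed : zmod_closed null_vectors.
Proof.
split; first by rewrite /in_mem /= /null_vectors seminorm0.
move=> x y /eqP x0 /eqP y0; rewrite /in_mem/= /null_vectors eq_le seminorm_ge0 andbT.
by rewrite (le_trans (ND _ _))// seminormN x0 y0 addr0.
Qed.

HB.instance Definition _ := GRing.isZmodClosed.Build E null_vectors
  null_vectors_zmod_closed.

Definition seminorm_quotient := Quotient.quot null_vectors.
HB.instance Definition _ := GRing.Zmodule.on seminorm_quotient.
HB.instance Definition _ := EqQuotient.on seminorm_quotient.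

Local Notation V := seminorm_quotient.
Local Notation cl := (\pi_V).

Lemma class_eqP x y : cl x = cl y <-> N (x - y) = 0.
Proof.
split=> [/eqP|xy]; first by rewrite -Quotient.idealrBE => /eqP.
by apply/eqP; rewrite -Quotient.idealrBE; apply/eqP.
Qed.

Let clD x y : cl (x + y) = cl x + cl y.
Proof. exact: raddfD. Qed.

(* Scaling and norm are computed on a representative. *)
Let scale (a : R) (v : V) : V := cl (a *: repr v).

Let scale_cl a x : scale a (cl x) = cl (a *: x).
Proof.
apply/class_eqP; rewrite -scalerBr NZ.
by have /class_eqP -> : cl (repr (cl x)) = cl x by [rewrite reprK]; rewrite mulr0.
Qed.

Let norm (v : V) : R := N (repr v).

Let norm_cl x : norm (cl x) = N x.
Proof.
have /class_eqP H : cl (repr (cl x)) = cl x by rewrite reprK.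
have /class_eqP H' : cl x = cl (repr (cl x)) by rewrite reprK.
apply/eqP; rewrite eq_le /norm; apply/andP; split.
  by rewrite -[X in N X](subrK x) (le_trans (ND _ _))// H add0r.
by rewrite -[X in N X](subrK (repr (cl x))) (le_trans (ND _ _))// H' add0r.
Qed.

Let scaleA a b v : scale a (scale b v) = scale (a * b) v.
Proof.
by rewrite -[v]reprK (scale_cl b) (scale_cl a) (scale_cl (a * b)) scalerA.
Qed.

Let scale1 : left_id 1 scale.
Proof. by move=> v; rewrite -[v]reprK scale_cl scale1r. Qed.

Let scaleDr : right_distributive scale +%R.
Proof.
move=> a u v; rewrite -[u]reprK -[v]reprK -clD !scale_cl.
by rewrite -clD scalerDr.
Qed.

Let scaleDl v : {morph scale^~ v : a b / a + b}.
Proof. by move=> a b; rewrite -[v]reprK !scale_cl -clD scalerDl. Qed.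

HB.instance Definition _ := GRing.Zmodule_isLmodule.Build R V
  scaleA scale1 scaleDr scaleDl.

Let normD (u v : V) : norm (u + v) <= norm u + norm v.
Proof. by rewrite -[u]reprK -[v]reprK -clD !norm_cl. Qed.

Let normZ (a : R) (v : V) : norm (a *: v) = `|a| * norm v.
Proof. by rewrite -[v]reprK [_ *: _]scale_cl !norm_cl NZ. Qed.

Let norm0_eq0 (v : V) : norm v = 0 -> v = 0.
Proof.
rewrite -[v]reprK norm_cl => v0.
have -> : 0 = cl 0 by rewrite raddf0.
by apply/class_eqP; rewrite subr0.
Qed.

HB.instance Definition _ := Lmodule_isNormed.Build R V normD normZ norm0_eq0.

(** Dividing by the vectors of seminorm zero turns a seminormed space into a
normed one. *)
Lemma seminorm_quotientP : exists (W : normedModType R) (j : {linear E -> W}),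
  (forall x y, j x = j y <-> N (x - y) = 0) /\ (forall x, `|j x| = N x).
Proof.
have jlin : linear (cl : E -> V).
  by move=> a x y; rewrite clD -scale_cl.
pose j : {linear E -> V} :=
  HB.pack (cl : E -> V) (GRing.isLinear.Build _ _ _ _ _ jlin).
exists V, j.
by split=> [x y|x]; [exact: class_eqP|exact: norm_cl].
Qed.

End SeminormQuotient.

(** * Examples of inputs *)

Section PowerTails.
Context {R : realType}.
Local Notation lambda := (@lebesgue_measure R).

Let derivable_powR_pos (a x : R) : 0 < x -> derivable (@powR R ^~ a) x 1.
Proof. by move=> x0; apply: derivable_powR; rewrite in_itv/= x0. Qed.

Lemma powRN_cvg0 (s : R) : 0 < s -> x `^ (- s) @[x --> +oo] --> (0 : R).
Proof.
move=> s0; apply/cvgrPdist_lt => e e0.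
have : \forall x \near +oo, (e^-1) `^ s^-1 < x :> R by exact: nbhs_pinfty_gt.
apply: filterS => x ex; have x0 : 0 < x by apply: le_lt_trans ex; exact: powR_ge0.
rewrite sub0r normrN ger0_norm ?powR_ge0// powRN invf_plt ?posrE ?powR_gt0//.
have := @gt0_ltr_powR R s s0 ((e^-1) `^ s^-1) x.
rewrite !nnegrE powR_ge0 (ltW x0) -powRrM mulVf ?gt_eqF// powRr1.
  by apply.
by rewrite invr_ge0 ltW.
Qed.

(** An antiderivative is [- (r - 1)^-1 * x ^ (1 - r)], which vanishes at
infinity. *)
Lemma integral_powRN (r : R) : 1 < r ->
  (\int[lambda]_(x in `[1%R, +oo[) (x `^ (- r))%:E = ((r - 1)^-1)%:E)%E.
Proof.
move=> r1; have s0 : 0 < r - 1 by rewrite subr_gt0.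
pose F (x : R) := (- (r - 1)^-1) *: (x `^ (- (r - 1))).
have pos (x : R) : 1 <= x -> 0 < x by exact: lt_le_trans.
have dF (x : R) : 0 < x -> is_derive x 1 F (x `^ (- r)).
  move=> x0.
  have H := is_derive1_powR (- (r - 1)) x0.
  have := is_deriveZ (- (r - 1)^-1) H.
  rewrite /GRing.scale/= mulrA mulrNN mulVf ?gt_eqF// mul1r.
  by have -> : - (r - 1) - 1 = - r by rewrite opprB addrAC subrr add0r.
rewrite (@ge0_continuous_FTC2y _ _ F 1 0).
- by rewrite -EFinB sub0r /F powR1 /GRing.scale/= mulr1 opprK.
- by move=> x _; exact: powR_ge0.
- apply: derivable_within_continuous => x; rewrite in_itv/= andbT => x1.
  exact/derivable_powR_pos/pos.
- rewrite -(scaler0 _ (- (r - 1)^-1)); apply: cvgZr; exact: powRN_cvg0.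
- by move=> x x1; have [] := dF _ (pos _ (ltW x1)).
- apply: cvg_at_right_filter; apply: differentiable_continuous.
  by apply/derivable1_diffP; have [] := dF _ ltr01.
- move=> x; rewrite in_itv/= andbT => x1.
  by rewrite derive1E; have [_ ->] := dF _ (pos _ (ltW x1)).
Qed.

Lemma integral_inv (b : R) : 1 < b ->
  (\int[lambda]_(x in `[1%R, b]) (x `^ (- 1))%:E = (ln b)%:E)%E.
Proof.
move=> b1; have pos (x : R) : 1 <= x -> 0 < x by exact: lt_le_trans.
rewrite (@continuous_FTC2 _ _ (@ln R) 1 b)//.
- by rewrite ln1 sube0.
- apply: derivable_within_continuous => x; rewrite in_itv/= => /andP[x1 _].
  exact/derivable_powR_pos/pos.
- split.
  + move=> x; rewrite in_itv/= => /andP[x1 _].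
    by have [] := is_derive1_ln (pos _ (ltW x1)).
  + by apply: cvg_at_right_filter; exact: continuous_ln.
  + by apply: cvg_at_left_filter; apply: continuous_ln; exact: pos (ltW b1).
- move=> x; rewrite in_itv/= => /andP[/ltW/pos x0 _].
  by rewrite derive1E; have [_ ->] := is_derive1_ln x0; rewrite powR_inv1// ltW.
Qed.

End PowerTails.

Section Inputs.
Context {R : realType}.
Local Notation mu := (@completed_lebesgue_measure R).
Local Notation LR := (caratheodory_type ((wlength (@idfun R))^*)%mu).

Lemma completed_measurable_fun d (Y : measurableType d) (D : set R) (f : R -> Y) :
  measurable D -> measurable_fun D f -> measurable_fun (D : set LR) f.
Proof.
move=> mD mf _ B mB; apply: borel_completed; exact: mf.
Qed.

Lemma ge0_integral_completed (D : set R) (f : R -> \bar R) :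
  measurable (D : set (measurableTypeR R)) ->
  measurable_fun (D : set (measurableTypeR R)) f ->
  (forall x, D x -> (0 <= f x)%E) ->
  (\int[mu]_(x in D) f x = \int[@lebesgue_measure R]_(x in D) f x)%E.
Proof.
move=> mD mf f0.
have mid : measurable_fun [set: LR] (id : LR -> measurableTypeR R).
  by move=> _ B mB; rewrite setTI; exact: borel_completed.
have mu_id (A : set (measurableTypeR R)) : measurable A ->
  mu (id @^-1` A) = lebesgue_measure A by [].
by rewrite (ge0_integral_preserving mid mu_id mD mf f0).
Qed.

Definition power_input (r x : R) : R := (1 + x) `^ (- r).

Lemma power_input_ge0 (r x : R) : 0 <= power_input r x.
Proof. exact: powR_ge0. Qed.

Lemma measurable_power_input (r : R) : measurable_fun [set: R] (power_input r).
Proof.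
apply: (@measurableT_comp _ _ _ R R R (@powR R ^~ (- r)) _ (fun x => 1 + x)).
  exact: measurable_powR.
exact: measurable_funD.
Qed.

Lemma measurable_power_input_nnreal (r : R) :
  measurable_fun [set: LR] (power_input r \_ nnreal).
Proof.
apply/(measurable_restrictT _ measurable_nnreal).
apply: completed_measurable_fun; first exact: measurable_itv.
by apply: measurable_funTS; exact: measurable_power_input.
Qed.

Lemma power_input_le1 (r x : R) : 0 <= r -> 0 <= x -> power_input r x <= 1.
Proof.
move=> r0 x0; rewrite /power_input powRN invf_le1 ?powR_gt0 ?ltr_pwDl//.
have := @ge0_ler_powR R r r0 1 (1 + x).
by rewrite powR1 !nnegrE ler01 lerDl x0 addr_ge0//; exact.
Qed.

Lemma integral_power_input (r : R) (D : set R) :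
  measurable (D : set (measurableTypeR R)) ->
  (\int[mu]_(x in (fun x : R => (x + 1)%R) @^-1` D) (power_input r x)%:E =
   \int[@lebesgue_measure R]_(x in D) (x `^ (- r))%:E)%E.
Proof.
move=> mD; have mf : measurable_fun D (fun x : R => (x `^ (- r))%:E).
  by apply: measurable_funTS; apply/measurable_EFinP; exact: measurable_powR.
have f0 (x : R) : D x -> (0 <= (x `^ (- r))%:E)%E.
  by move=> _; rewrite lee_fin powR_ge0.
have <- := ge0_integral_completed mD mf f0.
have := ge0_integral_preserving (measurable_shift 1)
  (fun A _ => completed_shift 1 A) (borel_completed mD)
  (completed_measurable_fun mD mf) f0.
by move=> ->; apply: eq_integral => x _; rewrite /power_input addrC.
Qed.

Lemma integral_power_input_nnreal (r : R) :
  (\int[mu]_(x in nnreal) (power_input r x)%:E =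
   \int[@lebesgue_measure R]_(x in `[1%R, +oo[) (x `^ (- r))%:E)%E.
Proof.
have <- := @integral_power_input r `[1, +oo[ (measurable_itv _).
congr integral; apply/seteqP.
by split => x; rewrite nnrealE /= in_itv/= andbT lerDr.
Qed.

Lemma integral_power_input_itv (r b : R) :
  (\int[mu]_(x in `[0%R, b]) (power_input r x)%:E =
   \int[@lebesgue_measure R]_(x in `[1%R, (1 + b)%R]) (x `^ (- r))%:E)%E.
Proof.
have <- := @integral_power_input r `[1, 1 + b] (measurable_itv _).
congr integral; apply/seteqP.
by split => x; rewrite /= !in_itv/= lerDr addrC lerD2l.
Qed.

Lemma locally_integrable_power_input (r : R) : 0 <= r ->
  locally_integrable_nnreal (power_input r).
Proof.
move=> r0; apply/locally_integrableP => b.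
apply: measurable_bounded_integrable.
- exact: completed_measurable_itv.
- apply: (@le_lt_trans _ _ (lebesgue_measure `[0, b]%classic)) => //.
  rewrite lebesgue_measure_itv/=.
  by case: ifP; rewrite ?ltry.
- apply: completed_measurable_fun => //.
  by apply: measurable_funTS; exact: measurable_power_input.
- exists 1; split; first exact: num_real.
  move=> y y1 x /=; rewrite in_itv/= => /andP[x0 _].
  by rewrite ger0_norm ?power_input_ge0// (le_trans _ (ltW y1))// power_input_le1.
Qed.

(** The integral over [[0, b]] is [ln (1 + b)]. *)
Lemma divergent_power_input :
  (\int[mu]_(x in nnreal) (power_input 1 x)%:E = +oo)%E.
Proof.
have lnle (b : R) : 0 < b ->
    ((ln (1 + b))%:E <= \int[mu]_(x in nnreal) (power_input 1 x)%:E)%E.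
  move=> b0; rewrite -integral_inv ?ltrDl// -integral_power_input_itv.
  have m1 := measurable_nnrealS (locally_integrable_power_input ler01)
    measurable_nnreal (@subset_refl _ _).
  apply: (@ge0_subset_integral _ LR R mu _ _ (completed_measurable_itv `[0, b])
    measurable_nnreal _ m1).
  - by move=> x _; rewrite lee_fin power_input_ge0.
  - by move=> x; rewrite nnrealE /= in_itv/= => /andP[].
case E : (\int[mu]_(x in nnreal) _)%E => [M| |] //; rewrite E in lnle; exfalso.
- have M0 : 0 <= M.
    by rewrite -lee_fin -E integral_ge0// => x _; rewrite lee_fin power_input_ge0.
  have e1 : 1 < expR (M + 1) by rewrite expR_gt1 ltr_pwDr.
  have := lnle (expR (M + 1) - 1); rewrite subr_gt0 => /(_ e1).
  by rewrite [1 + _]addrC subrK expRK lee_fin gerDl ler10.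
- by have := lnle 1 ltr01; rewrite leeNy_eq.
Qed.

(** The [q]-th power of [(1 + x)^-r] is [(1 + x)^-(r * q)], which is integrable
as its exponent is greater than [1] in absolute value. *)
Lemma Lp_power_input_fin (q r : R) : 1 <= q -> 0 <= r -> 1 < r * q ->
  Lp_nnreal q%:E (power_input r).
Proof.
move=> q1 r0 rq1.
apply/LfunE; split; first exact: measurable_power_input_nnreal.
rewrite Lnorm.unlock; apply: poweR_lty.
rewrite (_ : integral _ _ _ = \int[mu]_(x in nnreal) (power_input (r * q) x)%:E)%E.
  by rewrite integral_power_input_nnreal integral_powRN// ltry.
rewrite [RHS]integral_mkcond; apply: eq_integral => x _.
rewrite /= !patchE; case: ifPn => [|_].
  rewrite inE nnrealE => x0; rewrite ger0_norm ?power_input_ge0//.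
  by rewrite /power_input -powRrM mulNr.
by rewrite normr0 powR0// gt_eqF// (lt_le_trans ltr01).
Qed.

Lemma Lp_power_input_oo (r : R) : 0 <= r -> Lp_nnreal +oo%E (power_input r).
Proof.
move=> r0.
apply/LfunE; split; first exact: measurable_power_input_nnreal.
rewrite Lnorm.unlock; case: ifPn => // _.
apply: (@le_lt_trans _ _ 1%E); last exact: ltry.
apply/ess_supP; apply: aeW => x /=; rewrite lee_fin patchE.
case: ifPn => [|_]; last by rewrite normr0.
rewrite inE nnrealE => x0; rewrite ger0_norm ?power_input_ge0//.
exact: power_input_le1.
Qed.

End Inputs.

(** * The time-changed system *)

Section DivergentInputs.
Context {R : realType}.
Local Notation mu := (@completed_lebesgue_measure R).
Implicit Types (u v : R -> R).

(** [(1 + t)^-1] belongs to L^p for every [p > 1] but is not integrable. *)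
Lemma nonempty_divergent_normr (p : \bar R) : (1 <= p)%E -> p <> 1%E ->
  divergent_inputs p (fun r : R => `|r|) !=set0.
Proof.
move=> p1 pN1; exists (power_input 1).
have E : (fun r : R => `|r|) \o power_input 1 = power_input 1.
  by apply/funext => x; rewrite /= ger0_norm// power_input_ge0.
split.
- move: p p1 pN1 => [q|_ _|//]; last by apply: Lp_power_input_oo; exact: ler01.
  rewrite lee_fin => q1 qN1; apply: Lp_power_input_fin => //.
  by rewrite mul1r lt_neqAle q1 andbT; apply/eqP => q1E; apply: qN1; rewrite -q1E.
- by rewrite E; exact: locally_integrable_power_input.
- rewrite -[RHS](@divergent_power_input R); apply: eq_integral => x _.
  by rewrite ger0_norm// power_input_ge0.
Qed.

(** [(1 + t)^-2] is integrable but its square root is not. *)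
Lemma nonempty_divergent_sqrt :
  divergent_inputs 1%E (fun r : R => Num.sqrt `|r|) !=set0.
Proof.
exists (power_input 2).
have E x : Num.sqrt `|power_input 2 x| = power_input 1 x :> R.
  rewrite ger0_norm ?power_input_ge0// -powR12_sqrt ?power_input_ge0//.
  by rewrite /power_input -powRrM mulNr mulfV.
split.
- by apply: Lp_power_input_fin; rewrite ?mulr1 ?ler0n ?ltr1n.
- have -> : (fun r : R => Num.sqrt `|r|) \o power_input 2 = power_input 1.
    by apply/funext => x /=; exact: E.
  exact: locally_integrable_power_input.
- rewrite -[RHS](@divergent_power_input R); apply: eq_integral => x _.
  by rewrite E.
Qed.

Variables (p : \bar R) (alpha : R -> R).
Hypotheses (p1 : (1 <= p)%E) (alpha_ge0 : forall r, 0 <= alpha r).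
Local Notation U := (divergent_inputs p alpha).

Let p0 : (0 < p)%E. Proof. exact: lt_le_trans p1. Qed.

Lemma ae_eq_comp u v : ae_eq_nnreal u v -> ae_eq_nnreal (alpha \o u) (alpha \o v).
Proof. by move=> uv; apply: (ae_weaken uv) => x {}uv /uv /= ->. Qed.

Lemma divergent_inputs_ae u v : U u -> ae_eq_nnreal u v -> U v.
Proof.
move=> [Lu lu du] uv; split.
- exact: ae_Lp_nnreal uv Lu.
- exact: ae_locally_integrable (ae_eq_comp uv) lu.
- rewrite -du.
  have lv := ae_locally_integrable (ae_eq_comp uv) lu.
  have mfu := measurable_nnrealS lu measurable_nnreal (@subset_refl _ _).
  have mfv := measurable_nnrealS lv measurable_nnreal (@subset_refl _ _).
  apply/esym; apply: (ge0_ae_eq_integral measurable_nnreal mfu mfv).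
  + by move=> x _; rewrite /= lee_fin; exact: alpha_ge0.
  + by move=> x _; rewrite /= lee_fin; exact: alpha_ge0.
  + by apply: (ae_weaken (ae_eq_comp uv)) => x /= {}uv /uv ->.
Qed.

Lemma divergent_inputs_shift u tau : 0 <= tau -> U u -> U (shift_input tau u).
Proof.
move=> tau0 [Lu lu du]; split.
- by have [] := Lp_shift p0 tau0 Lu.
- exact: (locally_integrable_shift tau0 lu).
- by have := divergent_shift (fun x => alpha_ge0 (u x)) tau0 lu du.
Qed.

Lemma comp_concat tau u v :
  alpha \o concat_input tau u v = concat_input tau (alpha \o u) (alpha \o v).
Proof. by apply/funext => x; rewrite /= /concat_input; case: ifP. Qed.

(** The function [u] is an input when this proves the stability of inputs under
concatenation, and the zero function when it serves to delay an input. *)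
Lemma divergent_inputs_concat u v tau : 0 <= tau -> Lp_nnreal p u ->
  locally_integrable_nnreal (alpha \o u) -> U v -> U (concat_input tau u v).
Proof.
move=> tau0 Lu lu [Lv lv dv]; split.
- exact: Lp_concat.
- by rewrite comp_concat; exact: locally_integrable_concat.
- have := divergent_concat (fun x => alpha_ge0 (u x)) (fun x => alpha_ge0 (v x))
    tau0 lu lv dv.
  by rewrite -comp_concat.
Qed.

(** The linear space is L^p of the real line, obtained as the quotient of the
seminormed space of measurable functions with finite L^p norm by those that
vanish almost everywhere. *)
Lemma Lp_norm_is_norm (X : normedModType R) (T : R -> X -> X) :
  input_norm_is_norm (time_changed_system p alpha T).
Proof.
pose N (f : LfunType mu p1) : R := fine ('N[mu]_p[EFin \o f])%E.
have ND (f g : LfunType mu p1) : N (f + g) <= N f + N g by exact: ler_LnormD.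
have NZ (a : R) (f : LfunType mu p1) : N (a *: f) = `|a| * N f.
  by rewrite /N LnormZ fineM// -finite_norm_fine.
have [W [j [jE jN]]] := seminorm_quotientP ND NZ.
(* The value at functions outside of L^p is arbitrary. *)
pose i u : W := if pselect (Lp_nnreal p u) is left Lu then j (Lfun_Sub p1 Lu) else 0.
exists W, i; split=> [u v [Lu _ _] [Lv _ _]|u [Lu _ _]]; last first.
  by rewrite /i; case: pselect => // Lu'; rewrite jN.
rewrite /i; case: pselect => // {}Lu; case: pselect => // {}Lv.
have subE x : (Lfun_Sub p1 Lu - Lfun_Sub p1 Lv : LfunType mu p1) x =
    (u \_ nnreal) x - (v \_ nnreal) x by [].
rewrite jE; split=> [uv|/ae_eq_restrict uv].
  apply: (ae_weaken (fine_Lnormr_eq0 uv)) => x /(_ I) + x0.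
  by rewrite subE !patchE mem_set// => /eqP; rewrite subr_eq0 => /eqP.
rewrite /N (@ae_Lnorm _ _ _ mu p p0 _ (cst 0)).
- by rewrite (_ : EFin \o cst 0 = cst 0%E)// Lnorm0// gt_eqF.
- exact: measurable_funP.
- exact: measurable_cst.
- by apply: (ae_weaken uv) => x uvx; rewrite subE uvx subrr.
Qed.

End DivergentInputs.

(** Uniform continuity on each [[0, b]] is enough: near a point [t] one takes
[b = t + 1]. *)
Lemma within_nnreal_continuous (R : realType) (X : normedModType R) (f : R -> X) :
  (forall b e, 0 < e -> exists2 d, 0 < d & forall s t, 0 <= s -> s <= t -> t <= b ->
    t - s < d -> `|f t - f s| < e) ->
  {within nnreal, continuous f}.
Proof.
move=> H; apply/subspace_continuousP => t; rewrite nnrealE => t0.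
apply/cvgrPdist_lt => e e0; have [d d0 Hd] := H (t + 1) e e0.
rewrite near_withinE; apply/nbhs_ballP; exists (Num.min d 1).
  by rewrite /= lt_min d0 ltr01.
move=> s; rewrite /ball/= lt_min => /andP[std st1]; rewrite nnrealE => s0.
have [ts|/ltW st] := leP t s.
  rewrite distrC; apply: Hd => //.
    by rewrite -lerBlDl (le_trans (ler_norm _))// distrC ltW.
  by rewrite (le_lt_trans (ler_norm _))// distrC.
by apply: Hd; rewrite ?lerDl// (le_lt_trans (ler_norm _)).
Qed.

Section TimeChangedSystem.
Context {R : realType} {X : completeNormedModType R}.
Variables (p : \bar R) (alpha : R -> R) (T : R -> X -> X).
Hypotheses (p1 : (1 <= p)%E) (alpha_ge0 : forall r, 0 <= alpha r).
Hypotheses (scs : strongly_continuous_semigroup T) (T_stable : strongly_stable T).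
Local Notation mu := (@completed_lebesgue_measure R).
Local Notation U := (divergent_inputs p alpha).
Local Notation S := (time_changed_system p alpha T).
Local Notation G u t := (\int[mu]_(s in `[0, t]) alpha (u s)).

Let p0 : (0 < p)%E. Proof. exact: lt_le_trans p1. Qed.

Lemma primitive_input_ge0 u t : 0 <= G u t.
Proof. exact: Rintegral_ge0. Qed.

Lemma time_changed_dynamical_system : U !=set0 -> dynamical_system_with_inputs S.
Proof.
move=> U0; split => /=.
- exact: U0.
- split => /=.
  + move=> u v _ uv; apply: aeW => t t0; apply: uv.
    by rewrite inE.
  + by move=> u v; exact: divergent_inputs_ae.
  + by move=> u v tau _ uv tau0; exact: ae_eq_shift.
  + by move=> u1 v1 u2 v2 tau _ _ uv1 uv2 _; exact: ae_eq_concat.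
  + move=> u v t x Uu uv t0; have [_ lv _] := divergent_inputs_ae p1 alpha_ge0 Uu uv.
    have [_ lu _] := Uu; congr (T _ x).
    exact: (ae_primitive t (ae_eq_comp alpha uv) lu lv).
- exact: Lp_norm_is_norm.
- move=> u tau Uu tau0; split; first exact: divergent_inputs_shift.
  by have [Lu _ _] := Uu; have [] := Lp_shift p0 tau0 Lu.
- move=> u1 u2 tau [L1 l1 _] U2 tau0; exact: divergent_inputs_concat.
- move=> x u [_ lu _].
  by rewrite (@primitive0 _ (alpha \o u) lu) (scs_0 scs).
- move=> x u s t [_ lu _] s0 t0.
  rewrite (@primitive_shift _ (alpha \o u) (fun r => alpha_ge0 (u r)) lu s t s0 t0)//.
  rewrite addrC (scs_D scs)//.
  + exact: (primitive_input_ge0 (shift_input s u)).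
  + exact: primitive_input_ge0.
- move=> x u [_ lu _]; apply: within_nnreal_continuous => b e e0.
  have [d d0 Hd] := semigroup_continuous scs T_stable x e0.
  have [d' d'0 Hd'] := @primitive_continuous _ (alpha \o u)
    (fun r => alpha_ge0 (u r)) lu b d d0.
  exists d' => // s t s0 st tb tsd'; apply: Hd.
  + exact: primitive_input_ge0.
  + exact: (@primitive_le _ (alpha \o u) (fun r => alpha_ge0 (u r)) lu).
  + exact: Hd'.
- move=> x u1 u2 tau _ _ tau0 u12 t; rewrite in_itv/= => /andP[t0 ttau].
  congr (T _ x); apply: eq_Rintegral => s; rewrite inE/= in_itv/= => /andP[s0 st].
  by rewrite u12// in_itv/= s0 (le_trans st).
Qed.

(** The state is bounded by [M * |x|] with [M] a bound of the semigroup. *)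
Lemma time_changed_uniformly_globally_stable : uniformly_globally_stable S.
Proof.
have [M M0 HM] := semigroup_bounded scs T_stable.
have M1 : 0 < M + 1 by rewrite ltr_wpDl.
(* [M] itself may be [0], and then [M * r] is not strictly increasing. *)
exists (fun r => (M + 1) * r), id; split.
- split.
  + by move=> r r0; rewrite mulr_ge0// ltW.
  + by apply: continuous_subspaceT => x; exact: mulrl_continuous.
  + by move=> r s _ rs; rewrite ltr_pM2l.
  + by rewrite mulr0.
- by split => //; apply: continuous_subspaceT => x.
- move=> x u t _ t0 /=; rewrite ler_wpDr//.
    by rewrite /Lp_norm_nnreal fine_ge0// Lnorm_ge0.
  rewrite (le_trans (HM _ _ (primitive_input_ge0 _ _)))// ler_wpM2r//.
  by rewrite lerDl.
Qed.

(** The clock exceeds any time from which the orbit of [x] stays in a given ball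
around [0]. *)
Lemma time_changed_weak_asymptotic_gain : weak_asymptotic_gain S.
Proof.
exists (cst 0); split; first by right.
move=> eps eps0 x u [_ lu du] /=.
have /cvgrPdist_lt/(_ eps eps0) [V [_ HV]] := @T_stable x.
have [t t0 Ht] := @primitive_diverges _ (alpha \o u) (fun s => alpha_ge0 (u s))
  lu du (V + 1).
exists t; split => // t' tt'; rewrite addr0 -normrN -sub0r ltW// HV//.
by rewrite (lt_le_trans _ (Ht _ tt'))// ltrDl.
Qed.

Lemma classK0_le (g : R -> R) (r s : R) : classK0 g -> 0 <= r -> r <= s -> g r <= g s.
Proof.
move=> [[_ _ gi _]|g0] r0 rs; last by rewrite !g0// (le_trans r0).
by move: rs; rewrite le_eqVlt => /predU1P[->//|rs]; exact/ltW/gi.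
Qed.

(** A fixed input [u] is delayed by the zero input for longer than the time [tau]
that a strong gain provides for [x]. At time [tau] the state still is [x],
while the bound [1 + gamma |u|] on it does not depend on [x]. *)
Lemma time_changed_not_strong_asymptotic_gain : alpha 0 = 0 -> U !=set0 ->
  (exists x : X, x <> 0) -> ~ strong_asymptotic_gain S.
Proof.
move=> alpha00 [u Uu] [x0 /eqP x0N0] [gamma [Kg Hg]].
have norm_ge0 v : 0 <= Lp_norm_nnreal p v by rewrite fine_ge0// Lnorm_ge0.
have g0 : 0 <= gamma (Lp_norm_nnreal p u).
  by case: Kg => [[+ _ _ _]|->//]; exact.
set c := gamma _ in g0.
(* A vector of norm [c + 2], above the bound [c + 1]. *)
pose x := (c + 2) / `|x0| *: x0.
have xE : `|x| = c + 2.
  rewrite normrZ normf_div normr_id divfK ?normr_eq0// ger0_norm//.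
  by rewrite addr_ge0.
have [tau [tau0 Htau]] := Hg 1 ltr01 x.
have tau10 : 0 <= tau + 1 by rewrite addr_ge0.
(* The delay is [tau + 1] and not [tau], for [v] to vanish at [tau] as well. *)
pose v := concat_input (tau + 1) (cst 0) u.
have [Lu _ _] := Uu.
have L0 : Lp_nnreal p (cst 0).
  rewrite /Lp_nnreal/= (_ : _ \_ _ = 0); first exact: (Lfun_addr_closed mu p1).1.
  by apply/funext => s; rewrite patchE; case: ifP.
have l0 : locally_integrable_nnreal (alpha \o cst 0).
  apply/locally_integrableP => b; rewrite (_ : EFin \o _ = cst 0%E).
    exact: integrable0.
  by apply/funext => s; rewrite /= alpha00.
have Uv : U v by exact: divergent_inputs_concat.
have := Htau tau v (lexx _) Uv; rewrite /=.
have -> : G v tau = 0.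
  rewrite /Rintegral integral0_eq// => s /=; rewrite in_itv/= => /andP[_ st].
  by rewrite /v /concat_input (le_lt_trans st) ?ltrDl// alpha00.
rewrite (scs_0 scs) xE; apply/negP; rewrite -ltNge.
rewrite addrC (@le_lt_trans _ _ (c + 1))// ?ltrD2l ?ltr1n//.
by rewrite lerD2r; apply: classK0_le => //; exact: Lp_norm_delay.
Qed.

End TimeChangedSystem.

Theorem mainTheorem2 (R : realType) (p : \bar R) (hp : (1 <= p)%E) :
  (p <> 1%E -> divergent_inputs p (fun r : R => `|r|) !=set0) /\
  (p = 1%E -> divergent_inputs p (fun r : R => Num.sqrt `|r|) !=set0) /\
  forall (alpha : R -> R)
    (alpha_ge0 : forall r, 0 <= alpha r) (alpha0 : alpha 0 = 0)
    (inputs_nonempty : divergent_inputs p alpha !=set0)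
    (X : completeNormedModType R) (X_nontrivial : exists x : X, x <> 0)
    (domA : set X) (A : X -> X) (T : R -> X -> X)
    (A_generates_T : generates domA A T) (T_stable : strongly_stable T),
    let S := time_changed_system p alpha T in
    dynamical_system_with_inputs S /\
    weakly_input_to_state_stable S /\
    ~ strongly_input_to_state_stable S.
Proof.
split; first exact: nonempty_divergent_normr.
split; first by move=> ->; exact: nonempty_divergent_sqrt.
move=> alpha alpha_ge0 alpha0 U0 X X_nontrivial domA A T [scs _] T_stable S.
split; first exact: time_changed_dynamical_system.
split.
  split; first exact: time_changed_uniformly_globally_stable.
  exact: time_changed_weak_asymptotic_gain.
by move=> [_]; exact: (time_changed_not_strong_asymptotic_gain hp alpha_ge0 scs).
Qed.
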